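(* Let $G$ be a $\Delta$-regular graph of order $n$ with independence number $\alpha<n$, and let $K_3(G)$ denote the number of triangles in $G$. Then $$3K_3(G)\ \leq\ n\binom{\Delta}{2}-\mathcal{P}_\alpha^*(G)\,\frac{\alpha\Delta\bigl(\alpha\Delta-(n-\alpha)\bigr)}{2(n-\alpha)}.$$
   Context: Graphs are finite and simple. A nonedge of $G$ is an unordered pair of distinct non-adjacent vertices. For an integer $k$, $\mathcal{W}_k$ is the set of independent sets of order $k$ in $G$. A function $w:\mathcal{W}_k\to[0,1]$ is a nonedge-fractional packing if for every nonedge $e$ of $G$, $\sum_{C\in\mathcal{W}_k:\,e\subseteq C}w(C)\leq1$. The nonedge-fractional packing number is $\mathcal{P}_k^*(G)=\max\{\sum_{C\in\mathcal{W}_k}w(C): w \text{ is a nonedge-fractional packing in } G\}$. *)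

(* Defs.v *)
From mathcomp Require Import all_boot all_order all_algebra.
From mathcomp Require Import all_classical all_reals all_analysis.

Set Implicit Arguments.
Unset Strict Implicit.
Unset Printing Implicit Defensive.

Import Order.TTheory GRing.Theory Num.Theory.
Import numFieldNormedType.Exports.

Local Open Scope ring_scope.

(* A finite simple graph is an adjacency relation [e] on a finite type [T] of
   vertices satisfying [simple_graph e]. *)
Definition simple_graph (T : finType) (e : rel T) : Prop :=
  symmetric e /\ irreflexive e.

Definition regular (T : finType) (e : rel T) (Delta : nat) : Prop :=
  forall x : T, #|[pred y | e x y]| = Delta.

Definition independent (T : finType) (e : rel T) (A : {set T}) : bool :=
  [forall x in A, forall y in A, ~~ e x y].

Definition clique (T : finType) (e : rel T) (A : {set T}) : bool :=
  [forall x in A, forall y in A, (x != y) ==> e x y].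

Definition independence_number (T : finType) (e : rel T) : nat :=
  \max_(A : {set T} | independent e A) #|A|.

Definition num_triangles (T : finType) (e : rel T) : nat :=
  #|[set A : {set T} | clique e A & #|A| == 3%N]%SET|.

Definition nonedge (T : finType) (e : rel T) (f : {set T}) : Prop :=
  exists x y : T, [/\ x != y, ~~ e x y & f = [set x; y]%SET].

Definition indep_sets (T : finType) (e : rel T) (k : nat) : {set {set T}} :=
  [set C : {set T} | independent e C & #|C| == k]%SET.

Definition packing_weight (R : realType) (T : finType) (e : rel T) (k : nat)
    (w : {set T} -> R) : R :=
  \sum_(C in indep_sets e k) w C.

(* A weight function is represented by a function on all vertex sets; its
   values outside [indep_sets e k] are neither constrained nor used. *)
Definition fractional_packing (R : realType) (T : finType) (e : rel T)
    (k : nat) (w : {set T} -> R) : Prop :=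
  (forall C, C \in indep_sets e k -> 0 <= w C <= 1) /\
  (forall f, nonedge e f ->
     \sum_(C in indep_sets e k | f \subset C) w C <= 1).

(* The supremum is attained, hence is the maximum: see
   [fractional_packing_number_attained] and [fractional_packing_number_ub]. *)
Definition fractional_packing_number (R : realType) (T : finType) (e : rel T)
    (k : nat) : R :=
  sup [set packing_weight e k w | w in @fractional_packing R T e k]%classic.

Lemma fractional_packing_number_ub (R : realType) (T : finType) (e : rel T)
    (k : nat) (w : {set T} -> R) :
  fractional_packing e k w ->
  packing_weight e k w <= fractional_packing_number R e k.
Proof.
move=> pw; apply: ub_le_sup; last by exists w.
exists (\sum_(C in indep_sets e k) 1) => _ [v [v01 _] <-].
by apply: ler_sum => C /v01 /andP[].
Qed.

Lemma fractional_packing_number_attained (R : realType) (T : finType)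
    (e : rel T) (k : nat) :
  exists2 w : {set T} -> R, fractional_packing e k w &
    packing_weight e k w = fractional_packing_number R e k.
Proof.
pose X := prod_topology (fun _ : {set T} => (R : topologicalType)).
pose B : set X := [set w | forall C, `[0 : R, 1]%classic (w C)]%classic.
have cB : compact B.
  apply: (@tychonoff _ (fun _ : {set T} => (R : topologicalType))
    (fun=> `[0 : R, 1]%classic)) => C.
  exact: segment_compact.
have sumC (P : pred {set T}) :
    continuous (fun w : X => \sum_(C | P C) (w C : R)).
  have addC : continuous (fun x : R * R => x.1 + x.2) by exact: add_continuous.
  have projC C : continuous (fun w : X => w C : R).
    exact: (@proj_continuous _ (fun _ : {set T} => (R : topologicalType)) C).
  exact: (@continuous_big R {set T} +%R 0 P addC X (index_enum _)
    (fun C (w : X) => w C) (fun C _ => projC C)).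
pose A : set X := (B `&` \bigcap_(f in [set f | nonedge e f])
  [set w : X | (\sum_(C in indep_sets e k | f \subset C) (w C : R)) <= 1])%classic.
have AP w : A w -> fractional_packing e k (w : {set T} -> R).
  move=> [Bw Nw]; split=> // C _.
  by have := Bw C; rewrite /= in_itv.
have A0 : (A !=set0)%classic.
  exists (fun=> 0 : R); split=> [C|f _] /=; first by rewrite in_itv /= lexx ler01.
  by rewrite big1.
have cA : compact A.
  apply: (@subclosed_compact _ _ B).
  - apply: closedI; first apply: compact_closed.
    + by apply: hausdorff_product => ?; exact: norm_hausdorff.
    + exact: cB.
    apply: closed_bigI => f _.
    apply: (@preimage_closed _ _ _ [set x : R | x <= 1]%classic);
      last exact: closed_le.
    by move=> w _; exact: sumC.
  - exact: cB.
  - by move=> w [].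
have [w] := compact_EVT_max A0 cA
  (continuous_subspaceT (sumC (fun C => C \in indep_sets e k))).
rewrite inE => /AP pw wmax; exists w => //.
apply/eqP; rewrite eq_le fractional_packing_number_ub //=.
apply: ge_sup; first by exists (packing_weight e k w), w.
move=> _ [v [v01 vN] <-].
pose v' : X := fun C => if C \in indep_sets e k then v C else 0.
have v'E (Q : pred {set T}) : \sum_(C in indep_sets e k | Q C) (v' C : R) =
    \sum_(C in indep_sets e k | Q C) v C.
  by apply: eq_bigr => C /andP[Ck _]; rewrite /v' Ck.
have /wmax : v' \in A.
  rewrite inE; split=> [C|f /vN]; last by rewrite /= v'E.
  rewrite /= in_itv /= /v'; case: ifP => [/v01 //|_].
  by rewrite lexx ler01.
suff -> : packing_weight e k v = \sum_(C in indep_sets e k) (v' C : R) by [].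
by apply: eq_bigr => C Ck; rewrite /v' Ck.
Qed.

(* Main.v *)
Require Import Defs.
From mathcomp Require Import all_boot all_order all_algebra.
From mathcomp Require Import all_classical all_reals all_analysis.
From mathcomp Require Import ring lra.

Set Implicit Arguments.
Unset Strict Implicit.

Import Order.TTheory GRing.Theory Num.Theory.
Local Open Scope ring_scope.

(** Call a pair of distinct neighbours of a vertex [x] a cherry at [x]. Every
    vertex carries [Delta choose 2] cherries, and a cherry is either closed (its
    two ends are adjacent, so that it spans a triangle) or open (its ends form a
    nonedge). Each triangle contains three closed cherries, so
    3 K_3 = n (Delta choose 2) - #(open cherries), and it remains to bound the
    number of open cherries from below.

    Give an open cherry with ends [y], [z] the total weight that an optimal
    fractional packing [w] puts on the maximum independent sets containing [y]
    and [z]. The packing condition at the nonedge {y, z} says that this is at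
    most 1 ([packing_le_open_cherries]), so there are at least
    sum_C w(C) * #(cherries with both ends in C) open cherries. For a fixed
    independent set [C], the alpha * Delta edges leaving [C] all end in the
    n - alpha vertices outside it, and by convexity the number of cherries with
    both ends in [C] is least when these edges are spread evenly
    ([cherries_indep_ge]). That bound does not depend on [C], hence it gets
    multiplied by the total weight of [w], the fractional packing number.

    All counts are made with ordered pairs, which doubles both sides and
    removes the halving hidden in the binomial coefficients. *)

Local Notation cherry e x p := [&& e x p.1, e x p.2 & p.1 != p.2].

Lemma card_offdiag (I : finType) (P : pred I) :
  (\sum_(p : I * I | [&& P p.1, P p.2 & p.1 != p.2]) 1 = #|P| * #|P|.-1)%N.
Proof.
rewrite -(pair_big_dep P (fun y z => P z && (y != z)) (fun _ _ => 1%N)) /=.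
rewrite -sum_nat_const; apply: eq_big => [y|y Py]; first by [].
rewrite sum1_card (cardD1 y P) (_ : y \in P) //=.
by apply: eq_card => z; rewrite !inE eq_sym andbC.
Qed.

(** A triangle [A] is counted six times on the right: once for each of its
    vertices as the centre [x] and each order of the other two. Conversely the
    centre and the pair determine [A], so no ordered triple is claimed by two
    different triangles. *)
Lemma num_triangles_le_ordered (T : finType) (e : rel T) :
  (6 * num_triangles e <= \sum_x \sum_(p : T * T |
     cherry e x p && e p.1 p.2) 1)%N.
Proof.
rewrite /num_triangles mulnC -sum_nat_const.
set tri := [set A | _]%SET.
pose inA (x : T) (p : T * T) (A : {set T}) :=
  [&& p.1 \in (A :\ x)%SET, p.2 \in (A :\ x)%SET & p.1 != p.2].
have six A : A \in tri -> (6 = \sum_(x in A) \sum_(p | inA x p A) 1)%N.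
  rewrite inE => /andP[_ /eqP cA].
  transitivity (\sum_(x in A) 2)%N; first by rewrite sum_nat_const cA.
  apply: eq_bigr => x xA; rewrite /inA (card_offdiag (mem (A :\ x)%SET)).
  rewrite (_ : #|mem (A :\ x)%SET| = 2%N) //.
  by move: (cardsD1 x A); rewrite xA cA => -[].
rewrite (eq_bigr _ six) (exchange_big_dep predT) //=.
apply: leq_sum => x _.
rewrite (exchange_big_dep (fun p => cherry e x p && e p.1 p.2)) /=;
  last first.
  move=> A [y z] /andP[]; rewrite inE => /andP[/forall_inP kA _] xA.
  rewrite /inA !inE /= => /and3P[/andP[yx yA] /andP[zx zA] yz].
  have adj u v : u \in A -> v \in A -> u != v -> e u v.
    by move=> uA vA; exact/implyP/(forall_inP (kA u uA)).
  by rewrite yz !adj // eq_sym.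
apply: leq_sum => -[y z] /= _; rewrite sum1_card.
apply/card_le1_eqP.
have det A : A \in [pred A | (A \in tri) && (x \in A) && inA x (y, z) A] ->
    A = [set x; y; z]%SET.
  rewrite !inE /= => /andP[/andP[/andP[_ /eqP cA] xA]].
  case/and3P; rewrite !inE /= => /andP[yx yA] /andP[zx zA] yz.
  apply/esym/eqP; rewrite eqEcard cA; apply/andP; split.
    by apply/fintype.subsetP => u; rewrite !inE => /orP[/orP[]|] /eqP->.
  rewrite finset.setUC cardsU1 cards2 !inE negb_or zx.
  by rewrite (eq_sym z) yz (eq_sym x) yx.
by move=> A B /det -> /det ->.
Qed.

(** The Cauchy-Schwarz inequality against a constant vector; it holds because
    the sum of the squared deviations from the mean is nonnegative. *)
Lemma sum_sqr_ge (R : realFieldType) (I : finType) (P : pred I) (d : I -> R) :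
  (0 < #|P|)%N ->
  (\sum_(i | P i) d i) ^+ 2 / #|P|%:R <= \sum_(i | P i) d i ^+ 2.
Proof.
move=> P0; set S := \sum_(i | P i) d i; set m : R := #|P|%:R.
have m0 : m != 0 by rewrite pnatr_eq0 -lt0n.
have : 0 <= \sum_(i | P i) (d i - S / m) ^+ 2.
  by apply: sumr_ge0 => i _; exact: sqr_ge0.
have -> : \sum_(i | P i) (d i - S / m) ^+ 2
    = \sum_(i | P i) d i ^+ 2 - S ^+ 2 / m.
  transitivity (\sum_(i | P i) (d i ^+ 2 - 2 * (S / m) * d i + (S / m) ^+ 2)).
    by apply: eq_bigr => i _; ring.
  rewrite big_split /= sumrB -mulr_sumr -/S sumr_const -[_ *+ _]mulr_natl -/m.
  by field.
by rewrite subr_ge0.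
Qed.

Lemma natr_mul_pred (R : comPzRingType) (k : nat) :
  (k * k.-1)%:R = k%:R ^+ 2 - k%:R :> R.
Proof.
case: k => [|k]; first by rewrite expr0n subr0.
by rewrite /= natrM -natr1; ring.
Qed.

Lemma natr_sum1 (R : pzSemiRingType) (I : finType) (P : pred I) :
  (\sum_(i | P i) 1)%:R = \sum_(i | P i) 1 :> R.
Proof. by rewrite natr_sum. Qed.

(** Let [d x] be the number of neighbours of [x] in [C], so that [x] is the
    centre of [d x * (d x - 1)] ordered cherries with both ends in [C]. As [C]
    is independent, [d] vanishes on [C]; outside [C] it sums to the number
    |C| * Delta of edges leaving [C]. The sum of squares is then bounded by
    [sum_sqr_ge] over the complement of [C] only, which is what produces the
    denominator |T| - |C|. *)
Lemma cherries_indep_ge (R : realType) (T : finType) (e : rel T)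
    (Delta : nat) (C : {set T}) :
  simple_graph e -> regular e Delta -> independent e C -> (#|C| < #|T|)%N ->
  #|C|%:R * Delta%:R * (#|C|%:R * Delta%:R - (#|T|%:R - #|C|%:R))
    / (#|T|%:R - #|C|%:R)
  <= \sum_x \sum_(p : T * T | cherry e x p
        && [&& p.1 \in C & p.2 \in C]) 1 :> R.
Proof.
move=> [esym _] reg /forall_inP indC ltC.
pose d x : nat := #|[pred y | e x y && (y \in C)]|.
have dC x : x \in C -> d x = 0%N.
  move=> xC; apply: eq_card0 => y; rewrite !inE.
  apply/negP => /andP[exy yC].
  by move: (forall_inP (indC x xC) y yC); rewrite exy.
(* Double counting of the edges leaving [C], seen from either end. *)
have sumd : (\sum_(x in ~: C) d x = #|C| * Delta)%N.
  transitivity (\sum_x d x)%N.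
    rewrite [RHS](bigID (mem C)) /= [X in (_ = X + _)%N]big1 ?add0n;
      last by exact: dC.
    by apply: eq_bigl => x; rewrite inE.
  transitivity (\sum_x \sum_(y | e x y && (y \in C)) 1)%N.
    by apply: eq_bigr => x _; rewrite sum1_card.
  rewrite (exchange_big_dep (mem C)) /=; last by move=> x y _ /andP[].
  rewrite -sum_nat_const; apply: eq_bigr => y yC.
  rewrite sum1_card -(reg y); apply: eq_card => x.
  by rewrite !inE /in_mem /= esym andbC; move: yC; rewrite /in_mem /= => ->.
have cC : #|(~: C)%SET|%:R = #|T|%:R - #|C|%:R :> R.
  by rewrite -(cardsC C) natrD addrC addKr.
have C0 : (0 < #|(~: C)%SET|)%N by rewrite -(ltn_add2l #|C|) addn0 cardsC.
have -> : \sum_x \sum_(p : T * T | cherry e x p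
        && [&& p.1 \in C & p.2 \in C]) 1 =
   \sum_(x in ~: C) ((d x)%:R ^+ 2 - (d x)%:R) :> R.
  transitivity (\sum_x ((d x)%:R ^+ 2 - (d x)%:R) : R).
    apply: eq_bigr => x _; rewrite -natr_mul_pred.
    rewrite -(card_offdiag [pred y | e x y && (y \in C)]) natr_sum.
    apply: eq_bigl => -[y z] /=.
    by case: (e x y); case: (e x z); case: (y != z); case: (y \in C);
      case: (z \in C).
  rewrite (bigID (mem C)) /= big1 ?add0r.
    by apply: eq_bigl => x; rewrite inE.
  by move=> x xC; rewrite dC // expr0n subr0.
rewrite sumrB -natr_sum sumd natrM.
have := @sum_sqr_ge R T (mem (~: C)%SET) (fun x => (d x)%:R) C0.
rewrite -natr_sum sumd natrM cC.
have c0 : #|T|%:R - #|C|%:R != 0 :> R by rewrite -cC pnatr_eq0 -lt0n.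
(* Subtract the linear term |C| * Delta; what remains is an identity. *)
move/(fun h => lerB h (lexx (#|C|%:R * Delta%:R))); apply: le_trans.
by rewrite le_eqVlt; apply/orP; left; apply/eqP; field.
Qed.

(** After exchanging the sums, an ordered cherry [p] at [x] is counted with the
    total weight of the independent sets containing both its ends. Only open
    cherries occur, since two members of an independent set are not adjacent,
    and for those the packing condition bounds this weight by 1. *)
Lemma packing_le_open_cherries (R : realType) (T : finType) (e : rel T)
    (k : nat) (w : {set T} -> R) :
  fractional_packing e k w ->
  \sum_(C in indep_sets e k) w C * (\sum_x \sum_(p : T * T |
      cherry e x p && [&& p.1 \in C & p.2 \in C]) 1)
  <= \sum_x \sum_(p : T * T |
      cherry e x p && ~~ e p.1 p.2) 1.
Proof.
move=> [_ wN].
under eq_bigr do rewrite mulr_sumr.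
rewrite exchange_big /=; apply: ler_sum => x _.
under eq_bigr do [rewrite mulr_sumr; under eq_bigr do rewrite mulr1].
rewrite (exchange_big_dep (fun p =>
    cherry e x p && ~~ e p.1 p.2)) /=; last first.
  move=> C p; rewrite inE => /andP[/forall_inP iC _] /andP[-> /andP[yC zC]] /=.
  exact: (forall_inP (iC _ yC)).
apply: ler_sum => -[y z] /= /andP[cyz nyz]; have /and3P[_ _ yz] := cyz.
have /wN : nonedge e [set y; z]%SET by exists y, z.
apply: le_trans; rewrite le_eqVlt; apply/orP; left; apply/eqP.
by apply: eq_bigl => C; rewrite cyz finset.subUset !finset.sub1set.
Qed.

Theorem theorem21 (R : realType) (T : finType) (e : rel T)
    (n Delta alpha : nat)
    (hG : simple_graph e)
    (hreg : regular e Delta)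
    (hn : #|T| = n)
    (halpha : independence_number e = alpha)
    (hlt : (alpha < n)%N) :
  3 * (num_triangles e)%:R <=
    n%:R * ('C(Delta, 2))%:R
    - fractional_packing_number R e alpha
      * ((alpha%:R * Delta%:R * (alpha%:R * Delta%:R - (n%:R - alpha%:R)))
         / (2 * (n%:R - alpha%:R))).
Proof.
have [w pw <-] := fractional_packing_number_attained R e alpha.
pose tri : R := \sum_x \sum_(p : T * T |
  cherry e x p && e p.1 p.2) 1.
pose opn : R := \sum_x \sum_(p : T * T |
  cherry e x p && ~~ e p.1 p.2) 1.
have split_cherries : tri + opn = 2 * (n%:R * ('C(Delta, 2))%:R).
  rewrite /tri /opn -big_split /=.
  transitivity (\sum_(x : T) (2 * 'C(Delta, 2))%:R : R).
    apply: eq_bigr => x _; rewrite -(bigID (fun p : T * T => e p.1 p.2)) /=.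
    rewrite -natr_sum1 (card_offdiag (e x)) (_ : #|e x| = Delta); last first.
      by rewrite -(hreg x); apply: eq_card.
    by rewrite -[Delta.-1]ffactn1 -ffactnS -bin_ffact mulnC.
  by rewrite sumr_const -hn natrM -[_ *+ _]mulr_natl mulrCA.
have tri_ge : 6 * (num_triangles e)%:R <= tri.
  rewrite /tri -natrM; under eq_bigr do rewrite -natr_sum1.
  by rewrite -natr_sum ler_nat num_triangles_le_ordered.
have opn_ge : packing_weight e alpha w *
    (alpha%:R * Delta%:R * (alpha%:R * Delta%:R - (n%:R - alpha%:R))
     / (n%:R - alpha%:R)) <= opn.
  apply: le_trans (packing_le_open_cherries pw).
  rewrite /packing_weight mulr_suml; apply: ler_sum => C iC.
  have /andP[w0 _] := pw.1 C iC.
  move: iC; rewrite inE => /andP[indC /eqP cC]; apply: ler_wpM2l => //.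
  rewrite -cC -hn; apply: cherries_indep_ge => //.
  by rewrite cC hn.
have halve (a d : R) : a / (2 * d) = a / d / 2.
  by rewrite invfM mulrCA mulrC -mulrA.
rewrite halve mulrA; lra.
Qed.
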